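(* Let $N\ge1$, $h=1/N$, $\eta\in[0,\frac1{48})$, and for $j\in\{1,\dots,N\}$ let $\lambda_j=j^2\pi^2$ be the $j$-th Dirichlet eigenvalue of $-\frac{d^2}{dx^2}$ on $[0,1]$, and let $\hat\lambda^h_j$ be the $j$-th approximate eigenvalue of the $C^1$-quadratic softIGA discretization with $N$ uniform elements on $[0,1]$ and softness parameter $\eta$ (see context). Then $$\frac{|\hat\lambda^h_j-\lambda_j|}{\lambda_j}<\Big(\frac{37}{5040}+\eta\Big)(j\pi h)^4\qquad\text{for all } j\in\{1,\dots,N\}.$$ Moreover, if $\eta=\frac1{720}$, then $$\frac{|\hat\lambda^h_j-\lambda_j|}{\lambda_j}<\frac{1}{1680}(j\pi h)^6\qquad\text{for all } j\in\{1,\dots,N\}.$$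
   Context: The $C^1$-quadratic softIGA discretization of $-u''=\lambda u$ on $[0,1]$, $u(0)=u(1)=0$, is the generalized matrix eigenvalue problem $(\tilde K_2-\eta S_2)\hat U=\hat\lambda^h\tilde M_2\hat U$, where $\tilde K_2,\tilde M_2,S_2$ are the matrices, in the B-spline basis of $C^1$ piecewise quadratics on the uniform mesh vanishing at $0$ and $1$, of the bilinear forms $\int_0^1v'w'\,dx$, $\int_0^1 vw\,dx$, and $h^{3}\sum_{\text{interior nodes}}[\![v'']\!][\![w'']\!]+2h^3\big(v''(0)w''(0)+v''(1)w''(1)\big)$. Explicitly, they are $N\times N$ matrices of the form $$A_{kl}=\sum_{m\in\mathbb Z}\big(a_{|k-l+2Nm|}-a_{|k+l-1+2Nm|}\big),\qquad 1\le k,l\le N,$$ with stencils (entries not listed are $0$): $\tilde K_2$: $(a_0,a_1,a_2)=\frac1h(1,-\frac13,-\frac16)$; $\tilde M_2$: $(a_0,a_1,a_2)=h(\frac{11}{20},\frac{13}{60},\frac1{120})$; $S_2$: $(a_0,a_1,a_2,a_3)=\frac1h(20,-15,6,-1)$. With $t_j=j\pi h$, the approximate eigenvalue $\hat\lambda^h_j$ paired with $\lambda_j$ is the eigenvalue of this problem whose eigenvector is $\big(\sin((k-\tfrac12)t_j)\big)_{k=1}^N$; it equals $$\hat\lambda^h_j=\frac{80\sin^2(t_j/2)}{h^2}\cdot\frac{2-18\eta+(1+24\eta)\cos t_j-6\eta\cos 2t_j}{33+26\cos t_j+\cos 2t_j}.$$ (For $\eta\le\frac{3}{272}$ this coincides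 with listing eigenvalues in ascending order.) *)

(* Defs.v *)
From Stdlib Require Import Reals.
From Coquelicot Require Import Coquelicot.
Open Scope R_scope.

(** Cox-de Boor recursion.  When a denominator [t (i + p) - t i] vanishes,
    the lower-degree B-spline it multiplies is identically zero, so the usual
    convention "0/0 = 0" is respected whatever the value of [/ 0]. *)
Fixpoint bspline (t : nat -> R) (p i : nat) (x : R) : R :=
  match p with
  | O => if Rle_dec (t i) x then (if Rlt_dec x (t (S i)) then 1 else 0) else 0
  | S q =>
      (x - t i) / (t (i + p)%nat - t i) * bspline t q i x
      + (t (i + p + 1)%nat - x) / (t (i + p + 1)%nat - t (i + 1)%nat)
        * bspline t q (i + 1)%nat x
  end.

Definition mesh_size (N : nat) : R := / INR N.

(** Open knot vector of degree 2 on the uniform mesh of [0,1] with N elements: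
    0, 0, 0, h, 2h, ..., (N-1)h, 1, 1, 1  (indices 0, ..., N+4).
    The subtraction on indices is truncated. *)
Definition open_knot (N i : nat) : R :=
  INR (Nat.min (i - 2) N) * mesh_size N.

(** The N+2 quadratic B-splines over these knots have indices 0, ..., N+1.
    Only the first and the last are nonzero at an end point of [0,1] (as
    one-sided limits), so [basis N 1], ..., [basis N N] is the B-spline basis of
    the C^1 piecewise quadratics vanishing at 0 and 1. *)
Definition basis (N k : nat) : R -> R := bspline (open_knot N) 2 k.

Definition right_limit (f : R -> R) (x : R) : R :=
  iota (fun l : R => filterlim f (at_right x) (locally l)).

Definition left_limit (f : R -> R) (x : R) : R :=
  iota (fun l : R => filterlim f (at_left x) (locally l)).

Definition jump (f : R -> R) (x : R) : R := right_limit f x - left_limit f x.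

Definition stiffness_form (v w : R -> R) : R :=
  RInt (fun x => Derive v x * Derive w x) 0 1.

Definition mass_form (v w : R -> R) : R :=
  RInt (fun x => v x * w x) 0 1.

(** The basis functions are extended by zero outside [0,1], so v''(0) and v''(1)
    are the limits from inside the interval. *)
Definition softness_form (N : nat) (v w : R -> R) : R :=
  let h := mesh_size N in
  let v2 := Derive_n v 2 in
  let w2 := Derive_n w 2 in
  h ^ 3 * sum_n_m (fun i => jump v2 (INR i * h) * jump w2 (INR i * h)) 1 (N - 1)
  + 2 * h ^ 3 * (right_limit v2 0 * right_limit w2 0
                 + left_limit v2 1 * left_limit w2 1).

(** Matrices and vectors are indexed by 1, ..., N; other entries are never
    used. *)
Definition stiffness_matrix (N k l : nat) : R :=
  stiffness_form (basis N k) (basis N l).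

Definition mass_matrix (N k l : nat) : R :=
  mass_form (basis N k) (basis N l).

Definition softness_matrix (N k l : nat) : R :=
  softness_form N (basis N k) (basis N l).

Definition mat_vec (N : nat) (A : nat -> nat -> R) (U : nat -> R) (k : nat) : R :=
  sum_n_m (fun l => A k l * U l) 1 N.

Definition softIGA_eigenpair (N : nat) (eta mu : R) (U : nat -> R) : Prop :=
  (exists k, (1 <= k <= N)%nat /\ U k <> 0) /\
  forall k, (1 <= k <= N)%nat ->
    mat_vec N (fun i l => stiffness_matrix N i l - eta * softness_matrix N i l) U k
    = mu * mat_vec N (mass_matrix N) U k.

Definition sine_vector (N j k : nat) : R :=
  sin ((INR k - 1 / 2) * (INR j * PI * mesh_size N)).

(** Well defined because the mass matrix is positive definite, so an eigenvector
    determines its eigenvalue; [iota] is definite description. *)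
Definition approx_eigenvalue (N : nat) (eta : R) (j : nat) : R :=
  iota (fun mu : R => softIGA_eigenpair N eta mu (sine_vector N j)).

(** Eigenvalues of -u'' = lambda u, u(0) = u(1) = 0. *)
Definition exact_eigenvalue (j : nat) : R := INR j ^ 2 * PI ^ 2.

(* Main.v *)
(* Extended by odd reflection at both ends, a spline has ghost B-spline
   coefficients, and on every element it is the same combination of three uniform
   B-splines. Each bilinear form is thus a sum of identical local forms, and the
   row of its matrix at k, applied to the sampled sine (which is odd about both
   ends), is a symmetric stencil: the sine vector is an eigenvector, and the
   eigenvalue is a quotient of trigonometric polynomials in t = j pi h. With
   y = t^2 <= 10 and cos t = 1 - y/2 + y^2/24 - y^3/720 + y^4 z, where
   1/45360 <= z <= 1/40320, the error bounds become polynomial inequalities in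
   (y, z) on a box. *)
Require Import Defs.
From Stdlib Require Import Reals Bool Lra Lia Psatz.
From Coquelicot Require Import Coquelicot.
Open Scope R_scope.

(** * Error of the symbol *)

(** By the mean value theorem. It integrates a sign condition from [0], which turns each Taylor
    bound for [sin] or [cos] into the next one. *)
Lemma nonneg_of_derive (f df : R -> R) :
  f 0 = 0 -> (forall x, 0 <= x -> is_derive f x (df x)) ->
  (forall x, 0 <= x -> 0 <= df x) -> forall x, 0 <= x -> 0 <= f x.
Proof.
  intros f0 Hd Hdf x Hx.
  destruct (MVT_gen f 0 x df) as [c [Hc E]].
  - intros u Hu. rewrite Rmin_left in Hu by lra. apply Hd; lra.
  - intros u Hu. rewrite Rmin_left in Hu by lra.
    apply continuity_pt_filterlim, (ex_derive_continuous f).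
    exists (df u). apply Hd; lra.
  - rewrite Rmin_left in Hc by lra.
    rewrite f0 in E. assert (0 <= df c * (x - 0)) by (apply Rmult_le_pos; [apply Hdf|]; lra). lra.
Qed.

Ltac integrated H :=
  apply (nonneg_of_derive _ _) with (3 := H);
  [rewrite ?sin_0, ?cos_0; lra | intros x _; auto_derive; trivial; lra].

(** Ten successive integrations from [0], starting at [cos x <= 1]: each gives the next Taylor
    partial sum, alternately of [sin] and [cos]. *)
Lemma cos_bounds (t : R) : 0 <= t ->
  1 - t^2/2 + t^4/24 - t^6/720 + t^8/40320 - t^10/3628800 <= cos t
  <= 1 - t^2/2 + t^4/24 - t^6/720 + t^8/40320.
Proof.
  assert (S0 : forall x, 0 <= x -> 0 <= 1 - cos x).
  { intros x _; generalize (COS_bound x); lra. }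
  assert (S1 : forall x, 0 <= x -> 0 <= x - sin x) by integrated S0.
  assert (C1 : forall x, 0 <= x -> 0 <= cos x - (1 - x^2/2)) by integrated S1.
  assert (S2 : forall x, 0 <= x -> 0 <= sin x - (x - x^3/6)) by integrated C1.
  assert (C2 : forall x, 0 <= x -> 0 <= (1 - x^2/2 + x^4/24) - cos x) by integrated S2.
  assert (S3 : forall x, 0 <= x -> 0 <= (x - x^3/6 + x^5/120) - sin x) by integrated C2.
  assert (C3 : forall x, 0 <= x -> 0 <= cos x - (1 - x^2/2 + x^4/24 - x^6/720))
    by integrated S3.
  assert (S4 : forall x, 0 <= x -> 0 <= sin x - (x - x^3/6 + x^5/120 - x^7/5040))
    by integrated C3.
  assert (C4 : forall x, 0 <= x ->
    0 <= (1 - x^2/2 + x^4/24 - x^6/720 + x^8/40320) - cos x) by integrated S4.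
  assert (S5 : forall x, 0 <= x ->
    0 <= (x - x^3/6 + x^5/120 - x^7/5040 + x^9/362880) - sin x) by integrated C4.
  assert (C5 : forall x, 0 <= x ->
    0 <= cos x - (1 - x^2/2 + x^4/24 - x^6/720 + x^8/40320 - x^10/3628800))
    by integrated S5.
  intros Ht. specialize (C4 t Ht). specialize (C5 t Ht). lra.
Qed.

Lemma PI_sqr_lt_10 : PI ^ 2 < 10.
Proof.
  assert (Hpi : PI <= 158/50).
  { destruct (Rle_lt_dec PI (158/50)) as [|H]; [assumption|].
    pose proof (cos_gt_0 (158/100) ltac:(lra) ltac:(lra)).
    pose proof (cos_bounds (158/100) ltac:(lra)). lra. }
  pose proof PI_RGT_0. nra.
Qed.

(** Certifies a polynomial inequality of degree at most 9 in [y] and 3 in [z]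
    on a box by nonnegativity of its Bernstein coefficients. *)
Ltac bernstein y z y1 z0 z1 :=
  let x := fresh "x" in let s := fresh "s" in
  pose (x := y / y1); pose (s := (z - z0) / (z1 - z0));
  assert (0 <= x <= 1) by (unfold x; lra);
  assert (0 <= s <= 1) by (unfold s; lra);
  replace z with (z0 * (1 - s) + z1 * s) by (unfold s; field);
  replace y with (y1 * x) by (unfold x; field);
  clearbody x s;
  let H := fresh in
  assert (H : forall i j k l, 0 <= x ^ i * (1 - x) ^ j * s ^ k * (1 - s) ^ l)
    by (intros; repeat apply Rmult_le_pos; apply pow_le; lra);
  let row k l :=
    generalize (H 0 9 k l)%nat (H 1 8 k l)%nat (H 2 7 k l)%nat (H 3 6 k l)%nat
      (H 4 5 k l)%nat (H 5 4 k l)%nat (H 6 3 k l)%nat (H 7 2 k l)%nat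
      (H 8 1 k l)%nat (H 9 0 k l)%nat in
  row 0%nat 3%nat; row 1%nat 2%nat; row 2%nat 1%nat; row 3%nat 0%nat;
  clear - x s; intros; lra.

(** This is [h^2] times the closed formula for the eigenvalue, with sin^2(t/2) and cos(2t) expressed
    through [cos t]. *)
Definition softIGA_symbol (eta t : R) : R :=
  (20 * (1 - cos t) * (2 + cos t) - 240 * eta * (1 - cos t)^3)
  / (16 + 13 * cos t + cos t ^ 2).

Lemma mass_symbol_pos (t : R) : 0 < 16 + 13 * cos t + cos t ^ 2.
Proof. pose proof (COS_bound t). nra. Qed.

Section TaylorRemainder.
Variables y z : R.
Hypothesis Hy : 0 <= y <= 10.
Hypothesis Hz : 1/45360 <= z <= 1/40320.
(* With [y = t^2] and [cos t = 1 - y/2 + y^2/24 - y^3/720 + y^4 z], one has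
   [cos t = 1 - y w] and [16 + 13 cos t + cos t ^ 2 = M], and the relative
   error is [y^2 (B - 240 eta w^3) / M]. *)
Let v := 1/24 - y/720 + y^2 * z.
Let w := 1/2 - y * v.
Let M := 30 - 15*y*w + y^2*w^2.
Let B := 5*v - 1/6 - 60*y*z - 20*y*v^2 + y*v - y^2*v^2.

(** The constant is 1/720 + 10/1680: the value of [B / M] at [y = 0], plus the value at [y = 10] of
    the bound [y / 1680] that holds for [eta = 1/720]. *)
Lemma error_eta_0 : - (37/5040 * M) < B < 37/5040 * M.
Proof. split; unfold B, M, w, v; bernstein y z 10 (1/45360) (1/40320). Qed.

(** The endpoint [eta = 1/48], where [240 * eta = 5]. An upper bound at this end follows from
    [eta = 0], since [w^3] is nonnegative. *)
Lemma error_eta_max : - ((37/5040 + 1/48) * M) < B - 5 * w^3.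
Proof. unfold B, M, w, v; bernstein y z 10 (1/45360) (1/40320). Qed.

(* [B - w^3/3] is divisible by [y]. *)
Lemma error_eta_720 :
  - (M/1680)
  < -60*z - 1/144 + 5*y*z + 5/4*v - 20*v^2 - 3/2*y*v^2 + y^2*v^3/3 < M/1680.
Proof. split; unfold M, w, v; bernstein y z 10 (1/45360) (1/40320). Qed.

Lemma error_numerator (eta : R) : 0 <= eta < 1/48 ->
  Rabs (B - 240 * eta * w^3) < (37/5040 + eta) * M /\
  (eta = 1/720 -> 0 < y -> Rabs (B - 240 * eta * w^3) < 1/1680 * y * M).
Proof.
  intros Heta.
  assert (Hv : 0 <= v <= 1/24) by (unfold v; nra).
  assert (Hw : 0 <= w) by (unfold w; nra).
  assert (Hw3 : 0 <= w^3) by (apply pow_le; lra).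
  pose proof error_eta_0. pose proof error_eta_max.
  split.
  - apply Rabs_def1.
    + nra.
    + (* affine in [eta], hence enough at both ends of [0, 1/48] *)
      nra.
  - intros -> Hy0. pose proof error_eta_720.
    (* At [y = 0] the left side of the error bound is [1/24 - 30 * eta]; the value 1/720 cancels it,
       so a factor [y] splits off. *)
    replace (B - 240 * (1/720) * w^3) with
      (y * (-60*z - 1/144 + 5*y*z + 5/4*v - 20*v^2 - 3/2*y*v^2 + y^2*v^3/3))
      by (unfold B, w, v; field).
    rewrite Rabs_mult, (Rabs_right y) by lra.
    replace (1/1680 * y * M) with (y * (M/1680)) by field.
    apply Rmult_lt_compat_l; [assumption|]. apply Rabs_def1; lra.
Qed.
End TaylorRemainder.

Lemma symbol_error (eta t : R) : 0 <= eta < 1/48 -> 0 < t <= PI ->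
  Rabs (softIGA_symbol eta t - t^2) / t^2 < (37/5040 + eta) * t^4 /\
  (eta = 1/720 -> Rabs (softIGA_symbol eta t - t^2) / t^2 < 1/1680 * t^6).
Proof.
  intros Heta Ht. pose proof PI_sqr_lt_10.
  set (y := t^2).
  assert (Hy : 0 < y <= 10) by (unfold y; nra).
  set (z := (cos t - (1 - y/2 + y^2/24 - y^3/720)) / y^4).
  assert (Hy4 : 0 < y^4) by (apply pow_lt; lra).
  assert (Hc : cos t = 1 - y/2 + y^2/24 - y^3/720 + y^4 * z) by (unfold z; field; lra).
  pose proof (cos_bounds t ltac:(lra)) as Hb.
  replace (t^4) with (y^2) in * by (unfold y; ring).
  replace (t^6) with (y^3) in * by (unfold y; ring).
  replace (t^8) with (y^4) in * by (unfold y; ring).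
  replace (t^10) with (y^5) in * by (unfold y; ring).
  fold y in Hb |- *.
  (* The lower bound is 1/40320 - 10/3628800, from the last two Taylor terms and [y <= 10]. *)
  assert (Hz : 1/45360 <= z <= 1/40320).
  { split; apply Rmult_le_reg_l with (y^4); try assumption; [|lra].
    assert (y^4 * y <= y^4 * 10) by (apply Rmult_le_compat_l; lra).
    replace (y^5) with (y^4 * y) in Hb by ring. lra. }
  destruct (error_numerator y z ltac:(lra) Hz eta Heta) as [E1 E2].
  pose proof (mass_symbol_pos t) as HM.
  (* In terms of [y] and [z] the difference has a factor [y^3]; dividing by [t^2] leaves the [y^2]
     of the estimate. *)
  assert (E : softIGA_symbol eta t - y =
    y^3 * (5*(1/24 - y/720 + y^2 * z) - 1/6 - 60*y*z - 20*y*(1/24 - y/720 + y^2 * z)^2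
      + y*(1/24 - y/720 + y^2 * z) - y^2*(1/24 - y/720 + y^2 * z)^2
      - 240 * eta * (1/2 - y * (1/24 - y/720 + y^2 * z))^3)
    / (16 + 13 * cos t + cos t ^ 2)).
  { unfold softIGA_symbol. apply Rmult_eq_reg_r with (16 + 13 * cos t + cos t ^ 2); [|lra].
    field_simplify; [|lra|lra]. rewrite Hc. field. }
  rewrite E. clear E.
  set (D := 5*_ - _ - _ - _ + _ - _ - _) in *.
  replace (30 - 15*y*(1/2 - y * (1/24 - y/720 + y^2 * z))
      + y^2*(1/2 - y * (1/24 - y/720 + y^2 * z))^2)
    with (16 + 13 * cos t + cos t ^ 2) in * by (rewrite Hc; field).
  set (M := 16 + 13 * cos t + cos t ^ 2) in *.
  assert (A : Rabs (y^3 * D / M) / y = y^2 * (Rabs D / M)).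
  { unfold Rdiv. rewrite !Rabs_mult, Rabs_inv, (Rabs_right M), (Rabs_right (y^3));
      [field; lra| apply Rle_ge, pow_le; lra | lra]. }
  rewrite A. split; [|intros He; specialize (E2 He ltac:(lra))].
  - rewrite (Rmult_comm _ (y^2)). apply Rmult_lt_compat_l; [apply pow_lt; lra|].
    apply Rlt_div_l; assumption.
  - replace (1/1680 * y^3) with (y^2 * (1/1680 * y)) by ring.
    apply Rmult_lt_compat_l; [apply pow_lt; lra|].
    apply Rlt_div_l; assumption.
Qed.

(** * Bilinear forms of splines *)

(** The weights are the three pieces of the uniform quadratic B-spline, in the local coordinate [s]
    of an element. *)
Definition quad (a b c s : R) : R :=
  a * ((1 - s)^2 / 2) + b * (1/2 + s - s^2) + c * (s^2 / 2).

(* Over the uniform B-splines, the basis functions that touch the boundary have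
   ghost coefficients [-1] at the indices [0] and [N + 1]: they are odd
   reflections, which is where the reflected terms of the matrices come from. *)
Definition coef (N k i : nat) : R :=
  (if (i =? k)%nat then 1 else 0) - (if ((i =? 0) && (k =? 1))%nat%bool then 1 else 0)
  - (if ((i =? S N) && (k =? N))%nat%bool then 1 else 0).

(** Coefficients run over [0, ..., N + 1], both ends being ghosts. Elements are half-open, as in
    [bspline] at degree 0. *)
Definition is_spline (N : nat) (a : nat -> R) (f : R -> R) : Prop :=
  forall (e : nat) (x : R), (e < N)%nat ->
  INR e * mesh_size N <= x < INR (S e) * mesh_size N ->
  f x = quad (a e) (a (S e)) (a (S (S e))) (x / mesh_size N - INR e).

Lemma mesh_size_pos (N : nat) : (1 <= N)%nat -> 0 < mesh_size N.
Proof. intros HN. apply Rinv_0_lt_compat, lt_0_INR; lia. Qed.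

Lemma open_knot_eq (N i m : nat) :
  Nat.min (i - 2) N = m -> open_knot N i = INR m * mesh_size N.
Proof. intros <-. reflexivity. Qed.

(** The triple knot at [0] shifts indices by two: element [e] starts at knot [e + 2]. Repeated knots
    span empty intervals. *)
Lemma bspline_0_open_knot (N e i : nat) (x : R) : (e < N)%nat ->
  INR e * mesh_size N <= x < INR (S e) * mesh_size N ->
  bspline (open_knot N) 0 i x = if (i =? S (S e))%nat then 1 else 0.
Proof.
  intros He Hx. pose proof (mesh_size_pos N ltac:(lia)) as Hh.
  assert (le_knot : forall m n, (m <= n)%nat -> INR m * mesh_size N <= INR n * mesh_size N)
    by (intros; apply Rmult_le_compat_r; [lra | apply le_INR; assumption]).
  simpl bspline. unfold open_knot.
  destruct (Nat.eqb_spec i (S (S e))) as [-> | Hi].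
  - replace (Nat.min (S (S e) - 2) N) with e by lia.
    replace (Nat.min (S (S (S e)) - 2) N) with (S e) by lia.
    destruct Rle_dec; [destruct Rlt_dec|]; lra.
  - destruct (Nat.lt_total i (S (S e))) as [H | [H | H]]; [|lia|].
    + pose proof (le_knot (Nat.min (S i - 2) N) e ltac:(lia)).
      destruct Rle_dec; [destruct Rlt_dec|]; lra.
    + pose proof (le_knot (S e) (Nat.min (i - 2) N) ltac:(lia)).
      destruct Rle_dec; [destruct Rlt_dec|]; lra.
Qed.

Lemma bspline_S (t : nat -> R) (q i : nat) (x : R) :
  bspline t (S q) i x =
  (x - t i) / (t (i + S q)%nat - t i) * bspline t q i x
  + (t (i + S q + 1)%nat - x) / (t (i + S q + 1)%nat - t (i + 1)%nat)
    * bspline t q (i + 1)%nat x.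
Proof. reflexivity. Qed.

Ltac decide_eqb :=
  repeat match goal with
  | |- context [(?a =? ?b)%nat] =>
      first [replace (a =? b)%nat with true by (symmetry; apply Nat.eqb_eq; lia)
            |replace (a =? b)%nat with false by (symmetry; apply Nat.eqb_neq; lia)]
  end; rewrite ?andb_false_r; cbv beta iota delta [andb].

Ltac knot i m :=
  rewrite (open_knot_eq _ i m) by lia.

Ltac spline_field :=
  repeat rewrite ?Rmult_0_r, ?Rplus_0_l, ?Rplus_0_r, ?Rmult_1_r; rewrite ?S_INR; simpl INR;
  field; repeat split; lra.

(** The support of basis function [k] consists of those elements among [k - 2], [k - 1], [k] that
    exist; each is one case, and elsewhere both sides vanish. *)
Lemma basis_is_spline (N k : nat) : (1 <= k <= N)%nat ->
  is_spline N (coef N k) (basis N k).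
Proof.
  intros Hk e x He Hx. pose proof (mesh_size_pos N ltac:(lia)) as Hh.
  unfold basis. rewrite !bspline_S, !(bspline_0_open_knot N e) by assumption.
  unfold coef, quad.
  destruct (Nat.eq_dec e k) as [-> | H0].
  { decide_eqb.
    knot (k+2+1)%nat (S k). knot (k+1+1+1)%nat (S k). knot (k+1+1)%nat k.
    knot (k+1)%nat (k-1)%nat. rewrite minus_INR by lia. spline_field. }
  destruct (Nat.eq_dec (S e) k) as [<- | H1].
  (* On the middle element the outer knots [e - 1] and [e + 2] are clamped at the ends of the mesh;
     this is where ghost coefficients enter. *)
  { knot (S e+2+1)%nat (Nat.min (S (S e)) N). knot (S e+1+1)%nat (S e). knot (S e+2)%nat (S e).
    knot (S e+1)%nat e. knot (S e) (e-1)%nat.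
    destruct (Nat.eq_dec (S e) N) as [HN | HN];
      [replace (Nat.min (S (S e)) N) with (S e) by lia
      |replace (Nat.min (S (S e)) N) with (S (S e)) by lia];
      (destruct e as [|e]; [|rewrite minus_INR by lia]);
      decide_eqb; simpl Nat.sub; spline_field. }
  destruct (Nat.eq_dec (S (S e)) k) as [<- | H2].
  { decide_eqb.
    knot (S (S e)+2)%nat (S (S e)). knot (S (S e)+1)%nat (S e). knot (S (S e)) e.
    spline_field. }
  destruct (Nat.eq_dec k 1), (Nat.eq_dec k N); (lia || (decide_eqb; ring)).
Qed.

(** * Finite sums *)

Fixpoint rsum (F : nat -> R) (n : nat) : R :=
  match n with O => 0 | S m => rsum F m + F m end.

Lemma sum_n_m_1_rsum (F : nat -> R) (n : nat) :
  sum_n_m F 1 n = rsum (fun i => F (S i)) n.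
Proof.
  induction n as [|n IH].
  - apply (sum_n_m_zero (G := R_AbelianMonoid) F 1 0); lia.
  - rewrite sum_n_Sm, IH by lia. reflexivity.
Qed.

Lemma rsum_ext (F G : nat -> R) (n : nat) :
  (forall i, (i < n)%nat -> F i = G i) -> rsum F n = rsum G n.
Proof.
  induction n as [|n IH]; intros E; simpl; [reflexivity|].
  rewrite IH, (E n) by (intros; try apply E; lia). reflexivity.
Qed.

Lemma rsum_linear (F G : nat -> R) (x : R) (n : nat) :
  rsum (fun i => F i + x * G i) n = rsum F n + x * rsum G n.
Proof. induction n as [|n IH]; simpl; [|rewrite IH]; ring. Qed.

Lemma rsum_scal (F : nat -> R) (x : R) (n : nat) :
  rsum (fun i => x * F i) n = x * rsum F n.
Proof. induction n as [|n IH]; simpl; [|rewrite IH]; ring. Qed.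

Lemma rsum_zero (F : nat -> R) (n : nat) :
  (forall i, (i < n)%nat -> F i = 0) -> rsum F n = 0.
Proof.
  intros E. rewrite (rsum_ext F (fun _ => 0 * 0)) by (intros; rewrite E by assumption; ring).
  rewrite rsum_scal; ring.
Qed.

Lemma rsum_single (F : nat -> R) (n i : nat) : (i < n)%nat ->
  (forall j, (j < n)%nat -> j <> i -> F j = 0) -> rsum F n = F i.
Proof.
  induction n as [|n IH]; intros Hi E; [lia|]; simpl.
  destruct (Nat.eq_dec i n) as [->|].
  - rewrite rsum_zero; [ring|]. intros; apply E; lia.
  - rewrite IH, (E n); [ring| | | |]; try lia. intros; apply E; lia.
Qed.

(** Abel summation; the boundary terms will match the end point terms of the softness form. *)
Lemma rsum_by_parts (d J : nat -> R) (n : nat) :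
  rsum (fun i => (d (S i) - d i) * J (S i)) n + d 0%nat * J 0%nat - d n * J (S n)
  = rsum (fun e => d e * (J e - J (S e))) (S n).
Proof.
  induction n as [|n IH]; [simpl; ring|].
  change (rsum _ (S (S n))) with
    (rsum (fun e => d e * (J e - J (S e))) (S n) + d (S n) * (J (S n) - J (S (S n)))).
  rewrite <- IH; simpl; ring.
Qed.

(** The integral over [[0,1]] of a product of two [quad]s, whose coefficients in powers of [s] are
    the [c]s and the [d]s. *)
Definition local_mass (a0 a1 a2 b0 b1 b2 : R) : R :=
  let c0 := (a0 + a1) / 2 in let c1 := a1 - a0 in let c2 := (a0 - 2 * a1 + a2) / 2 in
  let d0 := (b0 + b1) / 2 in let d1 := b1 - b0 in let d2 := (b0 - 2 * b1 + b2) / 2 in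
  c0 * d0 + (c0 * d1 + c1 * d0) / 2 + (c0 * d2 + c1 * d1 + c2 * d0) / 3
  + (c1 * d2 + c2 * d1) / 4 + c2 * d2 / 5.

(** The derivative of [quad] interpolates linearly between successive differences; 1/3 and 1/6 are
    the integrals of products of hat functions. *)
Definition local_stiffness (a0 a1 a2 b0 b1 b2 : R) : R :=
  ((a1 - a0) * (b1 - b0) + (a2 - a1) * (b2 - b1)) / 3
  + ((a1 - a0) * (b2 - b1) + (a2 - a1) * (b1 - b0)) / 6.

Definition second_diff (a : nat -> R) (e : nat) : R :=
  a e - 2 * a (S e) + a (S (S e)).

Definition element_sum (q : R -> R -> R -> R -> R -> R -> R) (N : nat) (a b : nat -> R) : R :=
  rsum (fun e => q (a e) (a (S e)) (a (S (S e))) (b e) (b (S e)) (b (S (S e)))) N.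

(** On an element the second derivative is the constant [second_diff / h^2], so the powers of [h]
    combine to a single factor [1 / h]. *)
Definition softness_sum (N : nat) (a b : nat -> R) : R :=
  rsum (fun i => (second_diff a (S i) - second_diff a i)
                 * (second_diff b (S i) - second_diff b i)) (N - 1)
  + 2 * (second_diff a 0 * second_diff b 0
         + second_diff a (N - 1) * second_diff b (N - 1)).

Lemma is_RInt_quartic (c0 c1 c2 c3 c4 : R) :
  is_RInt (fun s => c0 + c1 * s + c2 * s^2 + c3 * s^3 + c4 * s^4) 0 1
    (c0 + c1 / 2 + c2 / 3 + c3 / 4 + c4 / 5).
Proof.
  pose (P s := c0 * s + c1 * s^2 / 2 + c2 * s^3 / 3 + c3 * s^4 / 4 + c4 * s^5 / 5).
  replace (c0 + c1 / 2 + c2 / 3 + c3 / 4 + c4 / 5) with (minus (P 1) (P 0))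
    by (unfold P, minus, plus, opp; simpl; field).
  apply (is_RInt_derive P).
  - intros s _. unfold P. auto_derive; trivial. field.
  - intros s _. apply (ex_derive_continuous (V := R_NormedModule)). auto_derive; trivial.
Qed.

Lemma is_RInt_element (F p : R -> R) (h I : R) (e : nat) : 0 < h ->
  (forall x, INR e * h < x < INR (S e) * h -> F x = p (x / h - INR e)) ->
  is_RInt p 0 1 I -> is_RInt F (INR e * h) (INR (S e) * h) (h * I).
Proof.
  intros Hh E Hp.
  apply (is_RInt_ext (fun x => scal h (scal (/ h) (p (/ h * x + - INR e))))).
  - intros x. rewrite S_INR in *. rewrite Rmin_left, Rmax_right by nra.
    intros Hx. rewrite E by assumption.
    change (h * (/ h * p (/ h * x + - INR e)) = p (x / h - INR e)).
    replace (x / h - INR e) with (/ h * x + - INR e) by (unfold Rdiv; ring).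
    field; lra.
  - apply (is_RInt_scal _ _ _ h I).
    apply (is_RInt_comp_lin p).
    replace (/ h * (INR e * h) + - INR e) with 0 by (field; lra).
    replace (/ h * (INR (S e) * h) + - INR e) with 1 by (rewrite S_INR; field; lra).
    assumption.
Qed.

Lemma is_RInt_mesh (F : R -> R) (h : R) (I : nat -> R) (n : nat) :
  (forall e, (e < n)%nat -> is_RInt F (INR e * h) (INR (S e) * h) (I e)) ->
  is_RInt F 0 (INR n * h) (rsum I n).
Proof.
  induction n as [|n IH]; intros H.
  - simpl. rewrite Rmult_0_l. apply (is_RInt_point F 0).
  - apply (is_RInt_Chasles F 0 (INR n * h) (INR (S n) * h) (rsum I n) (I n)).
    + apply IH. intros; apply H; lia.
    + apply H; lia.
Qed.

Lemma mesh_size_mul (N : nat) : (1 <= N)%nat -> INR N * mesh_size N = 1.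
Proof. intros HN. apply Rinv_r, not_0_INR; lia. Qed.

(** * Forms of splines as sums over elements *)

Section Splines.
Variable N : nat.
Hypothesis HN : (1 <= N)%nat.
Let h := mesh_size N.

Lemma RInt_mesh (F : R -> R) (p : nat -> R -> R) (I : nat -> R) :
  (forall e x, (e < N)%nat -> INR e * h < x < INR (S e) * h ->
     F x = p e (x / h - INR e)) ->
  (forall e, is_RInt (p e) 0 1 (I e)) ->
  RInt F 0 1 = rsum (fun e => h * I e) N.
Proof.
  intros E Hp. apply is_RInt_unique.
  pattern 1 at 1. rewrite <- (mesh_size_mul N HN).
  apply is_RInt_mesh. intros e He.
  apply (is_RInt_element _ (p e)); auto. apply mesh_size_pos; assumption.
Qed.

Section OneSpline.
Variables (a : nat -> R) (f : R -> R).
Hypothesis Hf : is_spline N a f.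

Lemma spline_Derive (e : nat) (x : R) : (e < N)%nat ->
  INR e * h < x < INR (S e) * h ->
  Derive f x = ((a (S e) - a e) * (1 - (x / h - INR e))
                + (a (S (S e)) - a (S e)) * (x / h - INR e)) / h.
Proof.
  intros He Hx. pose proof (mesh_size_pos N HN : 0 < h) as Hh.
  apply is_derive_unique.
  apply (is_derive_ext_loc
    (fun y => quad (a e) (a (S e)) (a (S (S e))) (y / h - INR e))).
  - apply (locally_interval _ x (INR e * h) (INR (S e) * h)); simpl; try apply Hx.
    intros y H1 H2. symmetry. apply Hf; [assumption|]. fold h. split; [left|]; assumption.
  - unfold quad. auto_derive; trivial. field; lra.
Qed.

Lemma spline_Derive_2 (e : nat) (x : R) : (e < N)%nat ->
  INR e * h < x < INR (S e) * h ->
  Derive_n f 2 x = second_diff a e / h^2.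
Proof.
  intros He Hx. pose proof (mesh_size_pos N HN : 0 < h) as Hh.
  apply is_derive_unique.
  apply (is_derive_ext_loc (fun x => ((a (S e) - a e) * (1 - (x / h - INR e))
                + (a (S (S e)) - a (S e)) * (x / h - INR e)) / h)).
  - apply (locally_interval _ x (INR e * h) (INR (S e) * h)); simpl; try apply Hx.
    intros y H1 H2. symmetry. apply spline_Derive; auto.
  - unfold second_diff. auto_derive; trivial. field; lra.
Qed.

Lemma spline_right_limit (e : nat) : (e < N)%nat ->
  right_limit (Derive_n f 2) (INR e * h) = second_diff a e / h^2.
Proof.
  intros He. pose proof (mesh_size_pos N HN : 0 < h) as Hh.
  apply (iota_filterlim_locally (V := R_CompleteNormedModule)).
  - apply (filterlim_ext_loc (fun _ => second_diff a e / h^2)); [|apply filterlim_const].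
    apply (locally_interval _ (INR e * h) m_infty (INR (S e) * h));
      [exact I | change (INR e * h < INR (S e) * h); rewrite S_INR; nra |].
    intros y _ H2 H1. symmetry. apply spline_Derive_2; auto.
Qed.

Lemma spline_left_limit (e : nat) : (e < N)%nat ->
  left_limit (Derive_n f 2) (INR (S e) * h) = second_diff a e / h^2.
Proof.
  intros He. pose proof (mesh_size_pos N HN : 0 < h) as Hh.
  apply (iota_filterlim_locally (V := R_CompleteNormedModule)).
  - apply (filterlim_ext_loc (fun _ => second_diff a e / h^2)); [|apply filterlim_const].
    apply (locally_interval _ (INR (S e) * h) (INR e * h) p_infty);
      [change (INR e * h < INR (S e) * h); rewrite S_INR; nra | exact I |].
    intros y H1 _ H2. symmetry. apply spline_Derive_2; auto.
Qed.
End OneSpline.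

Section TwoSplines.
Variables (a b : nat -> R) (f g : R -> R).
Hypotheses (Hf : is_spline N a f) (Hg : is_spline N b g).

Lemma mass_form_spline : mass_form f g = h * element_sum local_mass N a b.
Proof.
  unfold mass_form, element_sum. rewrite <- rsum_scal.
  apply (RInt_mesh _ (fun e s => quad (a e) (a (S e)) (a (S (S e))) s
                                 * quad (b e) (b (S e)) (b (S (S e))) s)).
  - intros e x He Hx. rewrite (Hf e), (Hg e) by (trivial; fold h; lra). reflexivity.
  - intros e. unfold local_mass, quad.
    eapply is_RInt_ext; [|apply is_RInt_quartic].
    intros s _. simpl. field.
Qed.

Lemma stiffness_form_spline :
  stiffness_form f g = element_sum local_stiffness N a b / h.
Proof.
  pose proof (mesh_size_pos N HN : 0 < h) as Hh.
  unfold stiffness_form, element_sum, Rdiv. rewrite Rmult_comm, <- rsum_scal.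
  rewrite (RInt_mesh _ (fun e s =>
      ((a (S e) - a e) * (1 - s) + (a (S (S e)) - a (S e)) * s) / h
      * (((b (S e) - b e) * (1 - s) + (b (S (S e)) - b (S e)) * s) / h))
    (fun e => / h^2 * local_stiffness (a e) (a (S e)) (a (S (S e)))
        (b e) (b (S e)) (b (S (S e))))).
  - apply rsum_ext. intros e _. field; lra.
  - intros e x He Hx.
    rewrite (spline_Derive a f Hf e), (spline_Derive b g Hg e) by assumption. reflexivity.
  - intros e. unfold local_stiffness.
    set (A := a (S e) - a e). set (A' := a (S (S e)) - a (S e)).
    set (B := b (S e) - b e). set (B' := b (S (S e)) - b (S e)).
    replace (/ h^2 * _) with
     (/ h^2 * (A * B) + / h^2 * (A * (B' - B) + (A' - A) * B) / 2
      + / h^2 * ((A' - A) * (B' - B)) / 3 + 0 / 4 + 0 / 5) by (field; lra).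
    eapply is_RInt_ext; [|apply is_RInt_quartic].
    intros s _. simpl. field; lra.
Qed.

Lemma softness_form_spline : softness_form N f g = softness_sum N a b / h.
Proof.
  pose proof (mesh_size_pos N HN : 0 < h) as Hh.
  unfold softness_form, softness_sum. rewrite sum_n_m_1_rsum.
  fold h. cbv zeta.
  rewrite (rsum_ext _ (fun i => / h^4 * ((second_diff a (S i) - second_diff a i)
                 * (second_diff b (S i) - second_diff b i)))).
  2:{ intros i Hi. unfold jump.
      rewrite (spline_right_limit a f), (spline_right_limit b g),
        (spline_left_limit a f), (spline_left_limit b g) by (trivial; lia).
      field; lra. }
  rewrite rsum_scal.
  replace (right_limit (Derive_n f 2) 0) with (right_limit (Derive_n f 2) (INR 0 * h))
    by (f_equal; simpl; ring).
  replace (right_limit (Derive_n g 2) 0) with (right_limit (Derive_n g 2) (INR 0 * h))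
    by (f_equal; simpl; ring).
  replace 1 with (INR (S (N - 1)) * h) at 1 2
    by (replace (S (N - 1)) with N by lia; apply mesh_size_mul; assumption).
  rewrite (spline_right_limit a f), (spline_right_limit b g),
    (spline_left_limit a f), (spline_left_limit b g) by (trivial; lia).
  field; lra.
Qed.
End TwoSplines.
End Splines.

(** * Eigenvectors *)

(** The first clause replaces functional extensionality and includes the ghost indices [0] and
    [N + 1]. *)
Definition linear_form (N : nat) (Phi : (nat -> R) -> R) : Prop :=
  (forall b c, (forall i, (i <= S N)%nat -> b i = c i) -> Phi b = Phi c) /\
  (forall b c x, Phi (fun i => b i + x * c i) = Phi b + x * Phi c).

Lemma linear_form_comb (N : nat) (Phi Psi : (nat -> R) -> R) (x y : R) :
  linear_form N Phi -> linear_form N Psi ->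
  linear_form N (fun b => x * Phi b + y * Psi b).
Proof.
  intros [E1 L1] [E2 L2]. split.
  - intros b c H. rewrite (E1 b c), (E2 b c) by assumption. reflexivity.
  - intros b c z. rewrite L1, L2. ring.
Qed.

Lemma linear_form_rsum (N : nat) (Phi : (nat -> R) -> R) (B : nat -> nat -> R)
  (U : nat -> R) (n : nat) : linear_form N Phi ->
  rsum (fun l => Phi (B l) * U l) n = Phi (fun i => rsum (fun l => U l * B l i) n).
Proof.
  intros [E L]. induction n as [|n IH]; simpl.
  (* Linearity with factor [-1] gives that [Phi] vanishes at zero. *)
  - pose proof (L (fun _ => 0) (fun _ => 0) (-1)) as H.
    rewrite (E _ (fun _ => 0)) in H by (intros; ring). lra.
  - rewrite L, IH. ring.
Qed.

Lemma linear_form_element_sum (q : R -> R -> R -> R -> R -> R -> R) (N : nat) (a : nat -> R) :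
  (forall a0 a1 a2 b0 b1 b2 c0 c1 c2 x,
     q a0 a1 a2 (b0 + x * c0) (b1 + x * c1) (b2 + x * c2)
     = q a0 a1 a2 b0 b1 b2 + x * q a0 a1 a2 c0 c1 c2) ->
  linear_form N (element_sum q N a).
Proof.
  intros L. unfold element_sum. split.
  - intros b c E. apply rsum_ext. intros e He.
    rewrite !E by lia. reflexivity.
  - intros b c x. rewrite <- rsum_linear. apply rsum_ext. intros e _. apply L.
Qed.

Lemma linear_form_softness_sum (N : nat) (a : nat -> R) : (1 <= N)%nat ->
  linear_form N (softness_sum N a).
Proof.
  intros HN. unfold softness_sum, second_diff. split.
  - intros b c E. rewrite !E by lia. f_equal. apply rsum_ext. intros i Hi.
    rewrite !E by lia. reflexivity.
  - intros b c x.
    match goal with |- rsum ?F _ + _ = rsum ?G _ + _ + _ * (rsum ?H _ + _) =>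
      rewrite (rsum_ext F (fun i => G i + x * H i)) by (intros; ring) end.
    rewrite rsum_linear. ring.
Qed.

(** In the first slot, elements see the indices [0, ..., N - 1]: the left ghost is met when [k = 1],
    and [k = N] is missed. The last slot is the mirror image. *)
Lemma rsum_coef_left (N k : nat) (G : nat -> R) : (1 <= k <= N)%nat ->
  rsum (fun e => coef N k e * G e) N
  = (if (k =? N)%nat then 0 else G k) - (if (k =? 1)%nat then G 0%nat else 0).
Proof.
  intros Hk.
  rewrite (rsum_ext _ (fun e => (if (e =? k)%nat then 1 else 0) * G e
    + (-1) * ((if ((e =? 0) && (k =? 1))%nat%bool then 1 else 0) * G e)))
    by (intros; unfold coef; decide_eqb; ring).
  rewrite rsum_linear.
  destruct (Nat.eq_dec k N), (Nat.eq_dec k 1);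
    [rewrite rsum_zero, (rsum_single _ N 0) | rewrite !rsum_zero
    |rewrite (rsum_single _ N k), (rsum_single _ N 0)
    |rewrite (rsum_single _ N k), rsum_zero];
    try (intros; lia); intros; decide_eqb; ring.
Qed.

Lemma rsum_coef_middle (N k : nat) (G : nat -> R) : (1 <= k <= N)%nat ->
  rsum (fun e => coef N k (S e) * G e) N = G (k - 1)%nat.
Proof.
  intros Hk. rewrite (rsum_single _ N (k - 1)); [|lia|]; intros; unfold coef;
  decide_eqb; ring.
Qed.

Lemma rsum_coef_right (N k : nat) (G : nat -> R) : (1 <= k <= N)%nat ->
  rsum (fun e => coef N k (S (S e)) * G e) N
  = (if (k =? 1)%nat then 0 else G (k - 2)%nat)
    - (if (k =? N)%nat then G (N - 1)%nat else 0).
Proof.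
  intros Hk.
  rewrite (rsum_ext _ (fun e => (if (S (S e) =? k)%nat then 1 else 0) * G e
    + (-1) * ((if ((S (S e) =? S N) && (k =? N))%nat%bool then 1 else 0) * G e)))
    by (intros; unfold coef; decide_eqb; ring).
  rewrite rsum_linear.
  destruct (Nat.eq_dec k N), (Nat.eq_dec k 1);
    [rewrite rsum_zero, (rsum_single _ N (N - 1))
    |rewrite (rsum_single _ N (k - 2)), (rsum_single _ N (N - 1))
    |rewrite !rsum_zero
    |rewrite (rsum_single _ N (k - 2)), rsum_zero];
    try (intros; lia); intros; decide_eqb; ring.
Qed.

(** * Rows of the matrices on odd sequences *)

Section Row.
Variables (N : nat) (U : R -> R).
Hypothesis U_reflect_0 : forall x, U (1 - x) = - U x.
Hypothesis U_reflect_1 : forall x, U (2 * INR N + 1 - x) = - U x.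

(* The elements that are missing next to the boundary are compensated by the
   ghost coefficients, because [U] is odd about both ends. *)
Lemma element_sum_row (q : R -> R -> R -> R -> R -> R -> R) (k : nat) :
  (1 <= k <= N)%nat ->
  (forall a0 a1 a2 b0 b1 b2, q a0 a1 a2 b0 b1 b2
     = a0 * q 1 0 0 b0 b1 b2 + a1 * q 0 1 0 b0 b1 b2 + a2 * q 0 0 1 b0 b1 b2) ->
  (forall b0 b1 b2, q 0 0 1 b0 b1 b2 = q 1 0 0 b2 b1 b0) ->
  (forall b0 b1 b2, q 1 0 0 (- b0) (- b1) (- b2) = - q 1 0 0 b0 b1 b2) ->
  let x := INR k in
  element_sum q N (coef N k) (fun i => U (INR i))
  = q 1 0 0 (U x) (U (x + 1)) (U (x + 1 + 1))
    + q 0 1 0 (U (x - 1)) (U x) (U (x + 1))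
    + q 0 0 1 (U (x - 1 - 1)) (U (x - 1)) (U x).
Proof.
  intros Hk Hlin Hsym Hodd x. unfold element_sum.
  set (Q a0 a1 a2 e := q a0 a1 a2 (U (INR e)) (U (INR e + 1)) (U (INR e + 1 + 1))).
  rewrite (rsum_ext _ (fun e => (coef N k e * Q 1 0 0 e + 1 * (coef N k (S e) * Q 0 1 0 e))
     + 1 * (coef N k (S (S e)) * Q 0 0 1 e))).
  2:{ intros e _. rewrite Hlin, !S_INR. unfold Q. ring. }
  rewrite !rsum_linear, rsum_coef_left, rsum_coef_middle, rsum_coef_right by assumption.
  assert (HQ0 : Q 1 0 0 k = q 1 0 0 (U x) (U (x + 1)) (U (x + 1 + 1))) by reflexivity.
  assert (HQ1 : Q 0 1 0 (k - 1)%nat = q 0 1 0 (U (x - 1)) (U x) (U (x + 1))).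
  { unfold Q. rewrite minus_INR by lia. fold x. simpl INR.
    f_equal; f_equal; ring. }
  assert (HL : k = 1%nat -> - Q 1 0 0 0%nat = q 0 0 1 (U (x - 1 - 1)) (U (x - 1)) (U x)).
  { intros ->. unfold Q, x. rewrite Hsym, <- Hodd, <- !U_reflect_0. simpl INR.
    f_equal; f_equal; ring. }
  assert (HR : k = N -> - Q 0 0 1 (N - 1)%nat = q 1 0 0 (U x) (U (x + 1)) (U (x + 1 + 1))).
  { intros E. unfold Q. rewrite Hsym, <- Hodd, <- !U_reflect_1, minus_INR by lia.
    unfold x. rewrite E. simpl INR. f_equal; f_equal; ring. }
  assert (HQ2 : k <> 1%nat ->
    Q 0 0 1 (k - 2)%nat = q 0 0 1 (U (x - 1 - 1)) (U (x - 1)) (U x)).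
  { intros E. unfold Q. rewrite minus_INR by lia. fold x. simpl INR.
    f_equal; f_equal; ring. }
  destruct (Nat.eqb_spec k 1) as [E1|E1], (Nat.eqb_spec k N) as [E2|E2];
    rewrite HQ1, <- ?(HL E1), <- ?(HQ2 E1), <- ?(HR E2), <- ?HQ0; ring.
Qed.

Variable c : R.
Hypothesis U_step : forall x, U (x + 1) = 2 * c * U x - U (x - 1).

Lemma U_step_back (x : R) : U (x - 1) = 2 * c * U x - U (x + 1).
Proof. rewrite U_step; ring. Qed.

(** The recurrence reduces all values of [U] to [U x] and [U (x - 1)]; by symmetry of the stencil
    the latter cancels. *)
Ltac symbol q :=
  rewrite element_sum_row; try assumption; [|intros; unfold q; field ..];
  rewrite !U_step, !Rplus_minus_r; set (x := INR _);
  replace (U (x - 1 - 1)) with (2 * c * U (x - 1) - U x)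
    by (rewrite (U_step_back (x - 1)); do 2 f_equal; ring);
  unfold q; field.

Lemma mass_row (k : nat) : (1 <= k <= N)%nat ->
  element_sum local_mass N (coef N k) (fun i => U (INR i))
  = (16 + 13 * c + c^2) / 30 * U (INR k).
Proof. intros Hk. symbol local_mass. Qed.

Lemma stiffness_row (k : nat) : (1 <= k <= N)%nat ->
  element_sum local_stiffness N (coef N k) (fun i => U (INR i))
  = 2/3 * (1 - c) * (2 + c) * U (INR k).
Proof. intros Hk. symbol local_stiffness. Qed.

Lemma second_diff_U (e : nat) :
  second_diff (fun i => U (INR i)) e = - (2 - 2 * c) * U (INR (S e)).
Proof.
  unfold second_diff. rewrite (S_INR (S e)), U_step.
  replace (INR (S e) - 1) with (INR e) by (rewrite S_INR; ring). ring.
Qed.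

Lemma softness_row (k : nat) : (1 <= k <= N)%nat ->
  softness_sum N (coef N k) (fun i => U (INR i)) = (2 - 2 * c)^3 * U (INR k).
Proof.
  intros Hk.
  set (u := fun i : nat => U (INR i)). set (d := second_diff (coef N k)).
  (* summation by parts moves one difference from the test function to [U] *)
  set (J e := - (2 - 2 * c) * (U (INR (S e)) - U (INR e))).
  assert (E : softness_sum N (coef N k) u
    = rsum (fun i => (d (S i) - d i) * J (S i)) (N - 1) + d 0%nat * J 0%nat
      - d (N - 1)%nat * J (S (N - 1))).
  { unfold softness_sum. fold d. unfold u. rewrite !second_diff_U.
    rewrite (rsum_ext _ (fun i => (d (S i) - d i) * J (S i))).
    2:{ intros i _. rewrite !second_diff_U. unfold J. ring. }
    (* By oddness [U 0 = - U 1] and [U (N + 1) = - U N], so the end differences of [U] are doubled: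
       this accounts for the weight 2 at the end points. *)
    unfold J. replace (S (N - 1)) with N by lia.
    rewrite (S_INR N).
    replace (U (INR N + 1)) with (- U (INR N))
      by (rewrite <- U_reflect_1; f_equal; ring).
    replace (U (INR 0)) with (- U (INR 1)) by (rewrite <- U_reflect_0; f_equal; simpl; ring).
    ring. }
  rewrite E, rsum_by_parts. replace (S (N - 1)) with N by lia.
  (* What remains is local to each element, since [J e - J (S e)] is [2 - 2 * c] times a second
     difference of [U]; the row lemma applies again. *)
  pose (q a0 a1 a2 b0 b1 b2 := (a0 - 2 * a1 + a2) * (b0 - 2 * b1 + b2)).
  rewrite (rsum_ext _ (fun e => (2 - 2 * c) *
      q (coef N k e) (coef N k (S e)) (coef N k (S (S e))) (u e) (u (S e)) (u (S (S e))))).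
  2:{ intros e _. unfold J, d, q, u, second_diff. ring. }
  rewrite rsum_scal.
  change (rsum _ N) with (element_sum q N (coef N k) (fun i => U (INR i))).
  symbol q.
Qed.
End Row.

(** * The sine vector and its eigenvalue *)

Section Eigenpair.
Variables (N j : nat).
Hypotheses (HN : (1 <= N)%nat) (Hj : (1 <= j <= N)%nat).
Let h := mesh_size N.
Let t := INR j * PI * h.
Let U (x : R) : R := sin ((x - 1/2) * t).

Lemma sine_reflect_0 (x : R) : U (1 - x) = - U x.
Proof. unfold U. rewrite <- sin_neg. f_equal. field. Qed.

(** Since [INR N * t = INR j * PI], reflection about the right end differs from oddness about the
    left one by [j] full periods. *)
Lemma sine_reflect_1 (x : R) : U (2 * INR N + 1 - x) = - U x.
Proof.
  unfold U. rewrite <- sin_neg, <- (sin_period (- ((x - 1/2) * t)) j). f_equal.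
  transitivity (- ((x - 1/2) * t) + 2 * INR j * PI * (INR N * h)); [unfold t; field|].
  unfold h. rewrite mesh_size_mul by assumption. ring.
Qed.

Lemma sine_step (x : R) : U (x + 1) = 2 * cos t * U x - U (x - 1).
Proof.
  unfold U.
  replace ((x + 1 - 1/2) * t) with ((x - 1/2) * t + t) by ring.
  replace ((x - 1 - 1/2) * t) with ((x - 1/2) * t - t) by ring.
  rewrite sin_plus, sin_minus. ring.
Qed.

(** By oddness the ghost coefficients of the sine combination are again samples of [U], so one
    formula covers all indices. *)
Lemma sine_coef (i : nat) : (i <= S N)%nat ->
  rsum (fun l => sine_vector N j (S l) * coef N (S l) i) N = U (INR i).
Proof.
  intros Hi. change (sine_vector N j) with (fun k => U (INR k)). cbv beta.
  destruct (Nat.eq_dec i 0) as [->|H0]; [|destruct (Nat.eq_dec i (S N)) as [->|H1]].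
  - rewrite (rsum_single _ N 0); [|lia|]; intros; unfold coef; decide_eqb; [|ring].
    replace (INR 0) with (1 - INR 1) by (simpl; ring). rewrite sine_reflect_0. ring.
  - rewrite (rsum_single _ N (N - 1)); [|lia|]; intros; unfold coef; decide_eqb; [|ring].
    replace (S (N - 1)) with N by lia.
    replace (INR (S N)) with (2 * INR N + 1 - INR N) by (rewrite S_INR; ring).
    rewrite sine_reflect_1. ring.
  - rewrite (rsum_single _ N (i - 1)); [|lia|]; intros; unfold coef; decide_eqb; [|ring].
    replace (S (i - 1)) with i by lia. ring.
Qed.

(** Row [k] is a linear form in the coefficients of the second argument, so the sum over columns
    moves inside it. *)
Lemma mat_vec_sine (A : nat -> nat -> R) (Phi : (nat -> R) -> R) (k : nat) :
  linear_form N Phi ->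
  (forall l, (1 <= l <= N)%nat -> A k l = Phi (coef N l)) ->
  mat_vec N A (sine_vector N j) k = Phi (fun i => U (INR i)).
Proof.
  intros HPhi HA. unfold mat_vec. rewrite sum_n_m_1_rsum.
  rewrite (rsum_ext _ (fun l => Phi (coef N (S l)) * sine_vector N j (S l)))
    by (intros; rewrite HA by lia; reflexivity).
  rewrite (linear_form_rsum N Phi (fun l => coef N (S l))
    (fun l => sine_vector N j (S l))) by assumption.
  apply HPhi. intros; apply sine_coef; assumption.
Qed.

Lemma mass_sine (k : nat) : (1 <= k <= N)%nat ->
  mat_vec N (mass_matrix N) (sine_vector N j) k
  = h * ((16 + 13 * cos t + cos t ^ 2) / 30) * sine_vector N j k.
Proof.
  intros Hk.
  (* The zero summand gives the form the shape required by [linear_form_comb]. *)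
  rewrite (mat_vec_sine _ (fun b => h * element_sum local_mass N (coef N k) b
                                    + 0 * element_sum local_mass N (coef N k) b)).
  - rewrite (mass_row N U sine_reflect_0 sine_reflect_1 (cos t) sine_step) by assumption.
    change (sine_vector N j k) with (U (INR k)). ring.
  - apply linear_form_comb; apply linear_form_element_sum;
      intros; unfold local_mass; field.
  - intros l Hl. unfold mass_matrix.
    rewrite (mass_form_spline N HN (coef N k) (coef N l)) by (apply basis_is_spline; assumption).
    fold h. ring.
Qed.

Lemma soft_stiffness_sine (eta : R) (k : nat) : (1 <= k <= N)%nat ->
  mat_vec N (fun i l => stiffness_matrix N i l - eta * softness_matrix N i l)
    (sine_vector N j) k
  = (2/3 * (1 - cos t) * (2 + cos t) - eta * (2 - 2 * cos t)^3) / h * sine_vector N j k.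
Proof.
  intros Hk. pose proof (mesh_size_pos N HN : 0 < h) as Hh.
  rewrite (mat_vec_sine _ (fun b => / h * element_sum local_stiffness N (coef N k) b
                                    + (- eta / h) * softness_sum N (coef N k) b)).
  - rewrite (stiffness_row N U sine_reflect_0 sine_reflect_1 (cos t) sine_step),
      (softness_row N U sine_reflect_0 sine_reflect_1 (cos t) sine_step) by assumption.
    change (sine_vector N j k) with (U (INR k)). field; lra.
  - apply linear_form_comb; [apply linear_form_element_sum|
      apply linear_form_softness_sum; assumption].
    intros; unfold local_stiffness; field.
  - intros l Hl. unfold stiffness_matrix, softness_matrix.
    rewrite (stiffness_form_spline N HN (coef N k) (coef N l)),
      (softness_form_spline N HN (coef N k) (coef N l))
      by (apply basis_is_spline; assumption).
    fold h. field; lra.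
Qed.

Lemma angle_bounds : 0 < t <= PI.
Proof.
  pose proof (mesh_size_pos N HN : 0 < h) as Hh. pose proof PI_RGT_0.
  pose proof (mesh_size_mul N HN) as E. fold h in E.
  assert (1 <= INR j) by (change 1 with (INR 1); apply le_INR; lia).
  assert (INR j <= INR N) by (apply le_INR; lia).
  assert (0 < INR j * h <= 1) by nra.
  unfold t. nra.
Qed.

Lemma sine_vector_1_pos : 0 < sine_vector N j 1.
Proof.
  pose proof angle_bounds. change (0 < U (INR 1)). unfold U. simpl INR.
  apply sin_gt_0; lra.
Qed.

(** Row [1] alone determines the eigenvalue, because the first sine entry and the mass multiplier
    are positive; the other rows hold with the same quotient. *)
Lemma approx_eigenvalue_eq (eta : R) :
  approx_eigenvalue N eta j = softIGA_symbol eta t / h^2.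
Proof.
  pose proof (mesh_size_pos N HN : 0 < h) as Hh.
  pose proof (mass_symbol_pos t) as HM. pose proof sine_vector_1_pos as H1.
  apply (iota_unique (V := R_CompleteNormedModule)).
  - intros mu [_ Hmu]. specialize (Hmu 1%nat ltac:(lia)).
    rewrite soft_stiffness_sine, mass_sine in Hmu by lia.
    rewrite <- Rmult_assoc in Hmu. apply Rmult_eq_reg_r in Hmu; [|lra].
    apply Rmult_eq_reg_r with (h * ((16 + 13 * cos t + cos t ^ 2) / 30)).
    + etransitivity; [symmetry; exact Hmu|]. unfold softIGA_symbol. field. lra.
    + apply Rgt_not_eq, Rmult_lt_0_compat; lra.
  - split.
    + exists 1%nat. split; [lia | lra].
    + intros k Hk. rewrite soft_stiffness_sine, mass_sine by assumption.
      unfold softIGA_symbol. field. lra.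
Qed.

Lemma relative_error_eq (eta : R) :
  Rabs (approx_eigenvalue N eta j - exact_eigenvalue j) / exact_eigenvalue j
  = Rabs (softIGA_symbol eta t - t^2) / t^2.
Proof.
  pose proof (mesh_size_pos N HN : 0 < h) as Hh. pose proof angle_bounds as Ht.
  assert (Hh2 : 0 < h^2) by (apply pow_lt; lra).
  rewrite approx_eigenvalue_eq.
  replace (exact_eigenvalue j) with (t^2 / h^2)
    by (unfold exact_eigenvalue, t; field; lra).
  replace (softIGA_symbol eta t / h^2 - t^2 / h^2)
    with ((softIGA_symbol eta t - t^2) * / h^2) by (field; lra).
  rewrite Rabs_mult, (Rabs_right (/ h^2))
    by (apply Rle_ge, Rlt_le, Rinv_0_lt_compat; assumption).
  field; lra.
Qed.
End Eigenpair.

Theorem theorem2 (N : nat) (HN : (1 <= N)%nat) (eta : R)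
  (Heta : 0 <= eta < 1 / 48) :
  (forall j : nat, (1 <= j <= N)%nat ->
     Rabs (approx_eigenvalue N eta j - exact_eigenvalue j) / exact_eigenvalue j
     < (37 / 5040 + eta) * (INR j * PI * mesh_size N) ^ 4) /\
  (eta = 1 / 720 ->
   forall j : nat, (1 <= j <= N)%nat ->
     Rabs (approx_eigenvalue N eta j - exact_eigenvalue j) / exact_eigenvalue j
     < 1 / 1680 * (INR j * PI * mesh_size N) ^ 6).
Proof.
  split; [intros j Hj | intros E j Hj]; rewrite relative_error_eq by assumption;
    pose proof (angle_bounds N j HN Hj) as Ht;
    destruct (symbol_error eta _ Heta Ht) as [H1 H2]; auto.
Qed.
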